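(* Let $X$ be a real normed space and let the following two conditions be valid: 1. there exists a nondecreasing function $\eta \colon [0,+\infty) \to [0,+\infty)$ such that $\eta(t)=0$ if and only if $t=0$ and $f(x) + \eta(\varphi(x)) \to +\infty$ as $\|x\| \to +\infty$; 2. for any $R>0$ there exist $\delta_R > 0$ and a continuous nondecreasing function $\omega_R \colon [0,+\infty) \to [0,+\infty)$ such that $\omega_R(t)=0$ if and only if $t=0$ and $\varphi(x) \ge \omega_R(\operatorname{dist}(x,\Omega))$ for all $x \in B(0,R)\setminus\Omega$ with $\varphi(x) < \delta_R$. Then for the problem $(\mathcal{P})$: minimize $f(x)$ subject to $x \in M$, $x \in Q$, to be weakly Levitin-Polyak well-posed with respect to the infeasibility measure $\varphi$ it is sufficient that this problem is weakly Levitin-Polyak well-posed in the extended sense.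
   Context: $M,Q \subset X$ are nonempty, $f \colon X \to \mathbb{R}\cup\{+\infty\}$. The feasible region $\Omega = M \cap Q$ is nonempty and the optimal value $f_* = \inf_{x\in\Omega} f(x)$ is finite; $\operatorname{argmin}(\mathcal{P})$ is the (possibly empty) set of globally optimal solutions of $(\mathcal{P})$. $\operatorname{dist}(x,V) = \inf_{y \in V} \|x-y\|$, $B(0,R) = \{x \in X \mid \|x\| \le R\}$. An infeasibility measure for the constraint $x \in M$ on $Q$ is a function $\varphi \colon X \to [0,+\infty]$ such that for any $x \in Q$ one has $\varphi(x)=0 \iff x \in M$; such a $\varphi$ is fixed. Convention: $\eta(+\infty) = +\infty$. $(\mathcal{P})$ is weakly Levitin-Polyak well-posed in the extended sense if $\operatorname{argmin}(\mathcal{P}) \ne \emptyset$ and for any sequence $\{x_n\} \subset X$ such that $f(x_n) \to f_*$ and $\operatorname{dist}(x_n,\Omega) \to 0$ one has $\operatorname{dist}(x_n, \operatorname{argmin}(\mathcal{P})) \to 0$. $(\mathcal{P})$ is weakly Levitin-Polyak well-posed with respect to $\varphi$ if $\operatorname{argmin}(\mathcal{P}) \ne \emptyset$ and for any sequence $\{x_n\} \subset X$ such that $f(x_n) \to f_*$ and $\varphi(x_n) \to 0$ one has $\operatorname{dist}(x_n, \operatorname{argmin}(\mathcal{P})) \to 0$. *)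

(* Defs.v *)
From HB Require Import structures.
From mathcomp Require Import all_boot all_order all_algebra.
From mathcomp Require Import all_classical all_reals all_analysis.
Set Implicit Arguments.
Unset Strict Implicit.
Unset Printing Implicit Defensive.
Import Order.TTheory GRing.Theory Num.Theory.
Import numFieldNormedType.Exports.
Local Open Scope classical_set_scope.
Local Open Scope ring_scope.

Section WellPosedness.
Context {R : realType} {X : normedModType R}.
Implicit Types (f phi : X -> \bar R) (M Q V : set X) (eta omega : R -> R).

(* Real-valued infimum: meaningful for V nonempty (it is 0 by convention for
   V = set0), and only ever used at nonempty sets. *)
Definition dist (x : X) V : R := inf [set `|x - y| | y in V].

Definition optval f V : \bar R := ereal_inf [set f x | x in V].

Definition argmin f V : set X :=
  [set x | V x /\ forall y, V y -> (f x <= f y)%E].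

Definition infeasibility_measure phi M Q : Prop :=
  (forall x, (0 <= phi x)%E) /\ (forall x, Q x -> (phi x = 0%E <-> M x)).

(* A nondecreasing function [0, +oo) -> [0, +oo) vanishing exactly at 0; the
   values of the underlying total function at negative reals are irrelevant. *)
Definition gauge_fun eta : Prop :=
  [/\ forall t, 0 <= t -> 0 <= eta t,
      forall s t, 0 <= s -> s <= t -> eta s <= eta t
    & forall t, 0 <= t -> (eta t = 0 <-> t = 0)].

(* g x --> +oo as `|x| --> +oo *)
Definition coercive (g : X -> \bar R) : Prop :=
  forall A : R, exists r : R, forall x, r <= `|x| -> (A%:E <= g x)%E.

Definition weakly_LP_extended f M Q : Prop :=
  argmin f (M `&` Q) !=set0 /\
  forall x_ : nat -> X,
    f (x_ n) @[n --> \oo] --> optval f (M `&` Q) ->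
    dist (x_ n) (M `&` Q) @[n --> \oo] --> (0 : R) ->
    dist (x_ n) (argmin f (M `&` Q)) @[n --> \oo] --> (0 : R).

Definition weakly_LP_wrt phi f M Q : Prop :=
  argmin f (M `&` Q) !=set0 /\
  forall x_ : nat -> X,
    f (x_ n) @[n --> \oo] --> optval f (M `&` Q) ->
    phi (x_ n) @[n --> \oo] --> 0%E ->
    dist (x_ n) (argmin f (M `&` Q)) @[n --> \oo] --> (0 : R).

End WellPosedness.

(* Main.v *)
(* Along a sequence with f --> f_* and phi --> 0, the quantity f + eta(phi) stays
   bounded, so coercivity confines a tail of the sequence to a ball.  On that ball
   omega(dist(x, Omega)) <= phi(x) holds as soon as phi(x) is small, and a
   monotone gauge reflects strict inequalities; hence dist(x_n, Omega) --> 0 and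
   well-posedness in the extended sense applies. *)

Require Import Defs.
From HB Require Import structures.
From mathcomp Require Import all_boot all_order all_algebra.
From mathcomp Require Import all_classical all_reals all_analysis.
Import Order.TTheory GRing.Theory Num.Theory.
Import numFieldNormedType.Exports.
Local Open Scope classical_set_scope.
Local Open Scope ring_scope.

Set Implicit Arguments.
Unset Strict Implicit.

Section dist_theory.
Context {R : realType} {X : normedModType R}.
Implicit Types (x : X) (V : set X).

Lemma dist_ge0 x V : V !=set0 -> 0 <= dist x V.
Proof.
move=> [v Vv]; apply: lb_le_inf; first by exists `|x - v|, v.
by move=> _ [y _ <-].
Qed.

Lemma dist_eq0 x V : V x -> dist x V = 0.
Proof.
move=> Vx; apply/eqP; rewrite eq_le dist_ge0 ?andbT; last by exists x.
apply: ge_inf; first by exists 0 => _ [y _ <-].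
by exists x; rewrite // subrr normr0.
Qed.

End dist_theory.

Section gauge_theory.
Context {R : realType}.
Implicit Type eta : R -> R.

Lemma gauge_gt0 eta (t : R) : gauge_fun eta -> 0 < t -> 0 < eta t.
Proof.
move=> [ge0 _ eq0] t0.
rewrite lt_neqAle ge0 ?(ltW t0) // andbT eq_sym; apply/eqP.
by move=> /(eq0 _ (ltW t0)) tE; rewrite tE ltxx in t0.
Qed.

(** Contrapositive of monotonicity. It extracts a bound on the argument without inverting [eta]. *)
Lemma gauge_ltW eta (s t : R) : gauge_fun eta -> 0 <= t -> eta s < eta t -> s < t.
Proof.
move=> [_ mono _] t0.
by apply: contraTT; rewrite -!leNgt; exact: mono.
Qed.

(** The finite bound [t] excludes [p = +oo], so only monotonicity on finite values remains. *)
Lemma er_map_gauge_le eta (p : \bar R) (t : R) :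
  gauge_fun eta -> (0 <= p)%E -> (p <= t%:E)%E -> (er_map eta p <= (eta t)%:E)%E.
Proof.
by move=> [_ mono _]; case: p => [p| |] //=; rewrite !lee_fin; exact: mono.
Qed.

End gauge_theory.

Lemma cvge_near_lt (R : realType) (T : Type) (F : set_system T) (FF : Filter F)
    (u : T -> \bar R) (l c : \bar R) :
  u x @[x --> F] --> l -> (l < c)%E -> \forall x \near F, (u x < c)%E.
Proof. by move=> ul /open_ereal_lt'; exact: ul. Qed.

Lemma near_bounded (R : realType) (X : normedModType R) (f phi : X -> \bar R)
    (eta : R -> R) (x_ : nat -> X) (l : \bar R) :
  gauge_fun eta -> coercive (fun x => (f x + er_map eta (phi x))%E) ->
  (forall x, (0 <= phi x)%E) -> l \is a fin_num ->
  f (x_ n) @[n --> \oo] --> l -> phi (x_ n) @[n --> \oo] --> 0%E ->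
  exists2 r : R, 0 < r & \forall n \near \oo, `|x_ n| <= r.
Proof.
move=> eta_g coer phi0 l_fin fl phil.
(* Eventually [f (x_ n) < l + 1] and [phi (x_ n) < 1], so the sum is at most [l + 1 + eta 1]; the
   last [+ 1] puts the coercivity threshold strictly above it. *)
have [r rP] := coer (fine l + 1 + eta 1 + 1).
(* Coercivity may return a nonpositive radius, while the error bound is available only for positive
   ones. *)
exists (Num.max r 1); first by rewrite lt_max ltr01 orbT.
have l1 : (l < (fine l + 1)%:E)%E by rewrite -{1}(fineK l_fin) lte_fin ltrDl.
near=> n; rewrite le_max; apply/orP; left; apply: contraT.
rewrite -ltNge => /ltW /rP; rewrite leNgt => /negP[].
have fn : (f (x_ n) < (fine l + 1)%:E)%E by near: n; exact: cvge_near_lt fl l1.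
have pn : (phi (x_ n) < 1%:E)%E.
  by near: n; apply: (cvge_near_lt _ phil); rewrite lte_fin.
apply: (@le_lt_trans _ _ ((fine l + 1)%:E + (eta 1)%:E)%E).
  by apply: leeD; [exact: ltW|apply: er_map_gauge_le => //; exact: ltW].
by rewrite -EFinD lte_fin ltrDl.
Unshelve. all: by end_near. Qed.

Lemma dist_cvg0_error_bound (R : realType) (X : normedModType R)
    (V : set X) (phi : X -> \bar R) (omega : R -> R) (r delta : R)
    (x_ : nat -> X) :
  V !=set0 -> 0 < delta -> gauge_fun omega ->
  (forall x, `|x| <= r -> ~ V x -> (phi x < delta%:E)%E ->
     ((omega (dist x V))%:E <= phi x)%E) ->
  (\forall n \near \oo, `|x_ n| <= r) ->
  phi (x_ n) @[n --> \oo] --> 0%E ->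
  dist (x_ n) V @[n --> \oo] --> (0 : R).
Proof.
move=> V0 delta0 omega_g bound xr phil; apply/cvgr0Pnorm_lt => e e0.
near=> n; rewrite ger0_norm ?dist_ge0 //.
(* The error bound is assumed only off [V]; on [V] the distance is zero. *)
have [Vn|nVn] := pselect (V (x_ n)); first by rewrite dist_eq0.
(* It suffices that [omega (dist (x_ n) V) < omega e]. Since [omega e > 0], eventually
   [phi (x_ n) < omega e], and the error bound places [omega (dist (x_ n) V)] below [phi (x_ n)]. *)
apply: (gauge_ltW omega_g (ltW e0)); rewrite -lte_fin.
apply: le_lt_trans (bound _ _ nVn _) _.
- by near: n.
- by near: n; apply: (cvge_near_lt _ phil); rewrite lte_fin.
- by near: n; apply: (cvge_near_lt _ phil); rewrite lte_fin gauge_gt0.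
Unshelve. all: by end_near. Qed.

Unset Implicit Arguments.

(* er_map eta extends eta by eta(+oo) = +oo. *)
Theorem proposition7 (R : realType) (X : normedModType R)
    (M Q : set X) (f phi : X -> \bar R)
    (M0 : M !=set0) (Q0 : Q !=set0) (MQ0 : M `&` Q !=set0)
    (f_gtNy : forall x : X, f x <> -oo%E)
    (optval_fin : optval f (M `&` Q) \is a fin_num)
    (phi_infeas : infeasibility_measure phi M Q)
    (growth : exists eta : R -> R,
      gauge_fun eta /\ coercive (fun x : X => (f x + er_map eta (phi x))%E))
    (error_bound : forall r : R, 0 < r ->
      exists (delta : R) (omega : R -> R),
        [/\ 0 < delta,
            gauge_fun omega,
            {within `[0, +oo[%classic, continuous omega}
          & forall x : X, `|x| <= r -> ~ (M `&` Q) x ->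
              (phi x < delta%:E)%E ->
              ((omega (dist x (M `&` Q)))%:E <= phi x)%E]) :
  weakly_LP_extended f M Q -> weakly_LP_wrt phi f M Q.
Proof.
(* Both notions share the nonempty [argmin] and [f (x_ n) --> f_*]; what is left is to derive
   [dist (x_ n) (M]&[Q) --> 0] from [phi (x_ n) --> 0]. *)
move=> [argmin0 ext]; split=> // x_ fl phil; apply: ext => //.
have [eta [eta_g coer]] := growth.
have [r r0 xr] := near_bounded eta_g coer phi_infeas.1 optval_fin fl phil.
have [delta [omega [delta0 omega_g _ bound]]] := error_bound _ r0.
exact: dist_cvg0_error_bound bound xr phil.
Qed.
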